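(* Let $(X,D)$ be an $\mathcal{F}$-metric space, $a\in X$, and $r>0$. Let $\mathbf{B}(a,r)=\{x\in X: D(a,x)\le r\}$. Suppose that for every sequence $\{x_n\}\subset X$ and every $x\in X$ with $\lim_{n\to+\infty}D(x_n,x)=0$, one has $$D(x,y)\le\limsup_{n\to+\infty}D(x_n,y)\quad\text{for all } y\in X.$$ Then $\mathbf{B}(a,r)$ is $\mathcal{F}$-closed.
   Context: $\mathbb{N}=\{0,1,2,\dots\}$. Let $\mathcal{F}$ be the set of functions $f:(0,+\infty)\to\mathbb{R}$ such that: $(\mathcal{F}_1)$ $f$ is non-decreasing, i.e. $0<s<t$ implies $f(s)\le f(t)$; $(\mathcal{F}_2)$ for every sequence $\{t_n\}\subset(0,+\infty)$, $\lim_{n\to+\infty}t_n=0$ if and only if $\lim_{n\to+\infty}f(t_n)=-\infty$. Let $X$ be a nonempty set and $D:X\times X\to[0,+\infty)$. $D$ is an $\mathcal{F}$-metric on $X$, and $(X,D)$ is an $\mathcal{F}$-metric space, if there exists $(f,\alpha)\in\mathcal{F}\times[0,+\infty)$ such that: (D1) for all $(x,y)\in X\times X$, $D(x,y)=0$ if and only if $x=y$; (D2) $D(x,y)=D(y,x)$ for all $(x,y)\in X\times X$; (D3) for every $(x,y)\in X\times X$, every $N\in\mathbb{N}$ with $N\ge2$, and every $(u_i)_{i=1}^N\subset X$ with $(u_1,u_N)=(x,y)$, if $D(x,y)>0$ then $f(D(x,y))\le f\left(\sum_{i=1}^{N-1}D(u_i,u_{i+1})\right)+\alpha$. For $x\in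 X$, $r>0$, put $B(x,r)=\{y\in X: D(x,y)<r\}$. A subset $\mathcal{O}\subset X$ is $\mathcal{F}$-open if for every $x\in\mathcal{O}$ there is $r>0$ with $B(x,r)\subset\mathcal{O}$. A subset $\mathcal{C}\subset X$ is $\mathcal{F}$-closed if $X\setminus\mathcal{C}$ is $\mathcal{F}$-open. The $\limsup$ is taken in $[0,+\infty]$. *)

(* Defs.v *)
From HB Require Import structures.
From mathcomp Require Import all_boot all_order all_algebra.
From mathcomp Require Import all_classical all_reals all_analysis.
Set Implicit Arguments.
Unset Strict Implicit.
Unset Printing Implicit Defensive.

Import Order.TTheory GRing.Theory Num.Theory.
Import numFieldNormedType.Exports.

Local Open Scope classical_set_scope.
Local Open Scope ring_scope.

(* A function (0, +oo) -> R is encoded as f : R -> R; only its values at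
   positive arguments are constrained or used. *)
Definition F_class (R : realType) (f : R -> R) : Prop :=
  (forall s t : R, 0 < s -> s < t -> f s <= f t) /\
  (forall t_ : nat -> R, (forall n, 0 < t_ n) ->
     (t_ n @[n --> \oo] --> (0 : R)) <-> (f (t_ n) @[n --> \oo] --> -oo%R)).

(* A finite family (u_i)_{1 <= i <= N} is given by u : nat -> X, of which only
   the values at 1, ..., N are used. *)
Definition F_metric (R : realType) (X : Type) (D : X -> X -> R) : Prop :=
  (forall x y, 0 <= D x y) /\
  exists (f : R -> R) (alpha : R),
    [/\ F_class f /\ 0 <= alpha,
        forall x y, D x y = 0 <-> x = y,
        forall x y, D x y = D y x &
        forall (x y : X) (N : nat) (u : nat -> X),
          (2 <= N)%N -> u 1%N = x -> u N = y -> 0 < D x y ->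
          f (D x y) <= f (\sum_(1 <= i < N) D (u i) (u i.+1)) + alpha].

Definition F_ball (R : realType) (X : Type) (D : X -> X -> R) (x : X) (r : R)
  : set X := [set y | D x y < r].

Definition F_closed_ball (R : realType) (X : Type) (D : X -> X -> R)
  (a : X) (r : R) : set X := [set x | D a x <= r].

Definition F_open (R : realType) (X : Type) (D : X -> X -> R) (O : set X)
  : Prop := forall x, O x -> exists2 r : R, 0 < r & F_ball D x r `<=` O.

Definition F_closed (R : realType) (X : Type) (D : X -> X -> R) (C : set X)
  : Prop := F_open D (~` C).

(* Main.v *)
Require Import Defs.
From HB Require Import structures.
From mathcomp Require Import all_boot all_order all_algebra.
From mathcomp Require Import all_classical all_reals all_analysis.
Set Implicit Arguments.
Unset Strict Implicit.
Unset Printing Implicit Defensive.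
Import Order.TTheory GRing.Theory Num.Theory.
Import numFieldNormedType.Exports.
Local Open Scope classical_set_scope.
Local Open Scope ring_scope.

(** If a point [x] outside the closed ball had no ball around it avoiding that set, the radii
    1/(n+1) would yield points of the closed ball converging to [x]. The limsup hypothesis, applied
    with [y := a], carries the bound [r] over to [D x a]: a contradiction. [limn_esup_le_cst] bounds
    the limsup. *)

Lemma limn_esup_le_cst (R : realType) (u : (\bar R)^nat) (c : \bar R) :
  (forall n, (u n <= c)%E) -> (limn_esup u <= c)%E.
Proof.
move=> uc; rewrite limn_esup_lim; apply: lime_le; first exact: is_cvg_esups.
by apply: nearW => n; apply: ge_ereal_sup => _ [k _ <-].
Qed.

Theorem proposition4p3 (R : realType) (X : Type) (D : X -> X -> R)
  (hD : F_metric D) (a : X) (r : R) (hr : 0 < r)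
  (hlim : forall (x_ : nat -> X) (x : X),
     (D (x_ n) x @[n --> \oo] --> (0 : R)) ->
     forall y : X, ((D x y)%:E <= limn_esup (fun n => (D (x_ n) y)%:E))%E) :
  F_closed D (F_closed_ball D a r).
Proof.
case: hD => [D_ge0 [f [alpha [_ _ D_sym _]]]] x /= /negP; rewrite -ltNge => rDax.
apply: contrapT => no_ball.
have /choice[x_ x_P] n : exists y, D x y < n.+1%:R^-1 /\ D a y <= r.
  (* Without such a [y], the ball of radius 1/(n+1) about [x] would lie in the complement, against
     [no_ball]. *)
  apply: contrapT => no_y; apply: no_ball; exists n.+1%:R^-1.
    by rewrite invr_gt0 ltr0Sn.
  by move=> y Dxy Day; apply: no_y; exists y.
have x_x : D (x_ n) x @[n --> \oo] --> (0 : R).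
  (* The radii 1/(n+1) are exactly the harmonic sequence, which tends to 0. *)
  apply: squeeze_cvgr (cvg_cst 0) cvg_harmonic.
  by apply: nearW => n; rewrite D_ge0 D_sym ltW // (x_P n).1.
(* Chaining with [hlim] at [a] gives D(x, a) ≤ r, against [rDax]. *)
have /(le_trans (hlim _ _ x_x a)) : (limn_esup (fun n => (D (x_ n) a)%:E) <= r%:E)%E.
  by apply: limn_esup_le_cst => n; rewrite lee_fin D_sym (x_P n).2.
by rewrite lee_fin D_sym leNgt rDax.
Qed.
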